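(* For all positive integers $m$ and $n$ there exist completely integrable polynomial vector fields of degree $m$ on $\mathbb{S}^n$.
   Context: $\mathbb{S}^n=\{x\in\mathbb{R}^{n+1} : \sum_i x_i^2=1\}$. A polynomial vector field $\chi=(P_1,\ldots,P_{n+1})$ in $\mathbb{R}^{n+1}$ is identified with the operator $\sum_i P_i\,\partial/\partial x_i$; its degree is $\max_i\deg P_i$. It is a vector field on $\mathbb{S}^n$ if $\chi(\sum_i x_i^2-1)=K(\sum_i x_i^2-1)$ for some real polynomial $K$. A first integral of $\chi$ on an open set $U\subset\mathbb{R}^{n+1}$ is a non-constant smooth map $G:U\to\mathbb{R}$ with $\chi G=0$ on $U$. The vector field $\chi$ in $\mathbb{R}^{n+1}$ is completely integrable in $U$ if it has $n$ independent first integrals on $U$, where independent means that their gradients are linearly independent at all points of $U$ outside a set of Lebesgue measure zero. Here $U=\mathbb{R}^{n+1}$. *)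

(* Defs.v *)
From mathcomp Require Import all_boot all_order all_algebra.
From mathcomp Require Import all_classical all_reals all_analysis.
(* The notations of [mpoly] are incompatible with those of MathComp-Analysis. *)
From mathcomp.multinomials Require Import -(notations) mpoly.
Import Order.TTheory GRing.Theory Num.Theory.
Import numFieldNormedType.Exports.

Set Implicit Arguments.
Unset Strict Implicit.
Unset Printing Implicit Defensive.

Local Open Scope classical_set_scope.
Local Open Scope ring_scope.

(* Lebesgue outer measure on R^N, from countable covers by closed boxes; its
   null sets are exactly the sets of Lebesgue measure zero. *)
Definition box (R : realType) (N : nat) (a b : 'rV[R]_N) : set 'rV[R]_N :=
  [set x | forall i, a 0 i <= x 0 i <= b 0 i].

Definition box_volume (R : realType) (N : nat) (a b : 'rV[R]_N) : R :=
  \prod_(i < N) Num.max 0 (b 0 i - a 0 i).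

Definition lebesgue_outer (R : realType) (N : nat) (A : set 'rV[R]_N) : \bar R :=
  ereal_inf [set v | exists a b : nat -> 'rV[R]_N,
    A `<=` \bigcup_k box (a k) (b k) /\
    v = (\sum_(0 <= k <oo) (box_volume (a k) (b k))%:E)%E].

Definition lebesgue_null (R : realType) (N : nat) (A : set 'rV[R]_N) : Prop :=
  lebesgue_outer A = 0%E.

Definition partial (R : realType) (N : nat) (i : 'I_N) (f : 'rV[R]_N -> R)
    (x : 'rV[R]_N) : R :=
  'D_(delta_mx 0 i) f x.

Definition gradient (R : realType) (N : nat) (f : 'rV[R]_N -> R)
    (x : 'rV[R]_N) : 'rV[R]_N :=
  \row_(i < N) partial i f x.

(* A map on an open set U is represented by a total function, of which only the
   values on U matter: partial derivatives at points of U depend only on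
   these. *)
Fixpoint Ck_on (R : realType) (N : nat) (k : nat) (U : set 'rV[R]_N)
    (f : 'rV[R]_N -> R) : Prop :=
  (forall x, U x -> {for x, continuous f}) /\
  if k is k'.+1 then
    forall i : 'I_N, (forall x, U x -> derivable f x (delta_mx 0 i)) /\
                     Ck_on k' U (partial i f)
  else True.

Definition smooth_on (R : realType) (N : nat) (U : set 'rV[R]_N)
    (f : 'rV[R]_N -> R) : Prop :=
  forall k, Ck_on k U f.

Definition poly_vector_field (R : realType) (N : nat) :=
  'I_N -> mpoly N R.

(* [msize p] is one more than the total degree of a nonzero [p]. *)
Definition vf_degree (R : realType) (N : nat) (X : poly_vector_field R N) : nat :=
  \max_(i < N) (msize (X i)).-1.

Definition vf_apply_poly (R : realType) (N : nat) (X : poly_vector_field R N)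
    (f : mpoly N R) : mpoly N R :=
  \sum_(i < N) X i * mderiv i f.

Definition vf_apply (R : realType) (N : nat) (X : poly_vector_field R N)
    (f : 'rV[R]_N -> R) (x : 'rV[R]_N) : R :=
  \sum_(i < N) meval (fun j => x 0 j) (X i) * partial i f x.

Definition sphere_poly (R : realType) (n : nat) : mpoly n.+1 R :=
  (\sum_(i < n.+1) mpolyX R (mnm1 i) ^+ 2) - 1.

Definition on_sphere (R : realType) (n : nat)
    (X : poly_vector_field R n.+1) : Prop :=
  exists K : mpoly n.+1 R,
    vf_apply_poly X (sphere_poly R n) = K * sphere_poly R n.

Definition first_integral (R : realType) (N : nat) (X : poly_vector_field R N)
    (U : set 'rV[R]_N) (G : 'rV[R]_N -> R) : Prop :=
  [/\ open U, smooth_on U G,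
      exists x y, [/\ U x, U y & G x <> G y] &
      forall x, U x -> vf_apply X G x = 0].

Definition independent_on (R : realType) (N r : nat) (U : set 'rV[R]_N)
    (G : 'I_r -> 'rV[R]_N -> R) : Prop :=
  exists Z : set 'rV[R]_N, lebesgue_null Z /\
    forall x, U x -> ~ Z x -> row_free (\matrix_(i < r) gradient (G i) x).

Definition completely_integrable (R : realType) (n : nat)
    (X : poly_vector_field R n.+1) (U : set 'rV[R]_n.+1) : Prop :=
  exists G : 'I_n -> 'rV[R]_n.+1 -> R,
    (forall i, first_integral X U (G i)) /\ independent_on U G.

(* Main.v *)
Require Import Defs.
From HB Require Import structures.
From mathcomp Require Import all_boot all_order all_algebra.
From mathcomp Require Import all_classical all_reals all_analysis.
From mathcomp Require Import ring.
From mathcomp.multinomials Require Import -(notations) mpoly.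
Import Order.TTheory GRing.Theory Num.Theory.
Import numFieldNormedType.Exports.

(** For distinct coordinates [i] and [j], the rotation field
    [x_j d/dx_i - x_i d/dx_j] annihilates [x_i^2 + x_j^2] and each of the
    remaining [n - 1] coordinate functions; hence so does its product with an
    arbitrary polynomial [q].  This gives [n] first integrals at once, and it
    also gives tangency to the sphere with cofactor [K = 0], since the field
    annihilates [x_0^2 + ... + x_n^2] too.  Taking [q = x_i^(m-1)] makes the
    degree equal to [m].

    The gradients are [2 x_i e_i + 2 x_j e_j] and [e_k] for [k] distinct from
    [i] and [j].  They are independent as soon as [x_i] is nonzero, that is,
    off a hyperplane, which is covered by countably many boxes of volume zero
    ([lebesgue_null_hyperplane]).

    All the functions involved are polynomial, so the analytic side amounts to
    the fact that the formal derivative of a polynomial computes the partial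
    derivative of its polynomial function ([is_derive_polyfun]).  Smoothness
    follows by iteration ([smooth_polyfun]), and the equation for a first
    integral becomes an identity in the polynomial ring
    ([vf_apply_polyfun]). *)

Set Implicit Arguments.
Unset Strict Implicit.
Unset Printing Implicit Defensive.

Local Open Scope classical_set_scope.
Local Open Scope ring_scope.

(** * Polynomial functions *)

Definition mvar (R : realType) (N : nat) (i : 'I_N) : mpoly N R :=
  mpolyX R (mnm1 i).

Definition polyfun (R : realType) (N : nat) (p : mpoly N R) (x : 'rV[R]_N) : R :=
  meval (fun j => x 0 j) p.

(** Induction along the generation of the polynomial algebra by constants and
    variables: continuity and differentiation both have sum and product rules,
    so this form suits them better than induction on monomials. *)
Lemma mpoly_alg_ind (R : realType) (N : nat) (P : mpoly N R -> Prop) :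
  (forall c, P (mpolyC N c)) -> (forall i, P (mvar R i)) ->
  (forall p q, P p -> P q -> P (p + q)) ->
  (forall p q, P p -> P q -> P (p * q)) ->
  forall p, P p.
Proof.
move=> PC PX PD PM; elim/mpolyind => [|c mon p _ _ Pp].
  by rewrite -(mpolyC0 N R); exact: PC.
apply: (PD) => //; rewrite -mul_mpolyC; apply: (PM) => //.
rewrite mpolyXE_id; apply: big_ind => [||i _]; [|exact: PM|].
  by rewrite -(mpolyC1 N R); exact: PC.
elim: (mon i) => [|k IH]; first by rewrite expr0 -(mpolyC1 N R); exact: PC.
by rewrite exprS; apply: (PM); [exact: PX|exact: IH].
Qed.

Lemma polyfunC (R : realType) (N : nat) (c : R) :
  polyfun (mpolyC N c) = cst c.
Proof. by apply/funext => x; rewrite /polyfun mevalC. Qed.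

Lemma polyfunX (R : realType) (N : nat) (i : 'I_N) :
  polyfun (mvar R i) = fun x : 'rV[R]_N => x 0 i.
Proof. by apply/funext => x; rewrite /polyfun mevalXU. Qed.

Lemma polyfunD (R : realType) (N : nat) (p q : mpoly N R) :
  polyfun (p + q) = polyfun p + polyfun q.
Proof. by apply/funext => x; rewrite /polyfun mevalD. Qed.

Lemma polyfunM (R : realType) (N : nat) (p q : mpoly N R) :
  polyfun (p * q) = polyfun p * polyfun q.
Proof. by apply/funext => x; rewrite /polyfun mevalM. Qed.

Lemma mderiv_mvar (R : realType) (N : nat) (i j : 'I_N) :
  mderiv i (mvar R j) = (j == i)%:R.
Proof.
rewrite mderivX mnm1E; case: eqP => [->|_]; last by rewrite scale0r.
have -> : mnm_sub (mnm1 i) (mnm1 i) = mnm0.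
  by apply/mnmP => k; rewrite mnmBE mnm0E subnn.
by rewrite mpolyX0 scale1r.
Qed.

Lemma mderiv_mvar_sqr (R : realType) (N : nat) (i k : 'I_N) :
  mderiv i (mvar R k ^+ 2) = (k == i)%:R * mvar R k *+ 2.
Proof. by rewrite expr2 mderivM mderiv_mvar [mvar R k * _]mulrC mulr2n. Qed.

Lemma continuous_polyfun (R : realType) (N : nat) (p : mpoly N R) :
  continuous (polyfun p).
Proof.
elim/mpoly_alg_ind: p => [c|i|p q cp cq|p q cp cq] x.
- by rewrite polyfunC; exact: cst_continuous.
- by rewrite polyfunX; exact: coord_continuous.
- by rewrite polyfunD; apply: continuousD; [exact: cp|exact: cq].
- by rewrite polyfunM; apply: continuousM; [exact: cp|exact: cq].
Qed.

Lemma is_derive_coord (R : realType) (N : nat) (i : 'I_N) (x v : 'rV[R]_N) :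
  is_derive x v (fun y : 'rV[R]_N => y 0 i) (v 0 i).
Proof.
apply: DeriveDef.
  exact/diff_derivable/differentiable_coord.
rewrite deriveE; last exact: differentiable_coord.
(* A continuous linear map is its own differential. *)
pose f : 'rV[R]_N -> R := fun y => y 0 i.
have lf : linear f by move=> a y z; rewrite /f !mxE.
pose fl := GRing.isLinear.Build _ _ _ _ f lf.
pose F : {linear 'rV[R]_N -> R} := HB.pack f fl.
have -> : (fun y : 'rV[R]_N => y 0 i) = F by [].
by rewrite diff_lin //; exact: coord_continuous.
Qed.

(** Analytic and formal differentiation agree on constants and variables and
    obey the same sum and product rules. *)
Lemma is_derive_polyfun (R : realType) (N : nat) (i : 'I_N) (p : mpoly N R)
    (x : 'rV[R]_N) :
  is_derive x (delta_mx 0 i) (polyfun p) (polyfun (mderiv i p) x).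
Proof.
elim/mpoly_alg_ind: p => [c|j|p q dp dq|p q dp dq].
- by rewrite mderivC polyfunC /polyfun meval0; exact: is_derive_cst.
- rewrite polyfunX; apply: is_derive_eq; first exact: is_derive_coord.
  by rewrite mderiv_mvar !mxE /polyfun -mpolyC_nat mevalC.
- by rewrite mderivD !polyfunD; exact: is_deriveD.
- rewrite mderivM polyfunM; apply: is_derive_eq.
  by rewrite polyfunD !polyfunM /= addrC mulrC.
Qed.

Lemma partial_polyfun (R : realType) (N : nat) (i : 'I_N) (p : mpoly N R) :
  partial i (polyfun p) = polyfun (mderiv i p).
Proof.
apply/funext => x; have dp := is_derive_polyfun i p x.
by rewrite /partial derive_val.
Qed.

Lemma smooth_polyfun (R : realType) (N : nat) (U : set 'rV[R]_N)
    (p : mpoly N R) : smooth_on U (polyfun p).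
Proof.
move=> k; elim: k p => [|k IH] p; split=> //=;
  try by move=> x _; exact: continuous_polyfun.
move=> i; rewrite partial_polyfun; split=> // x _.
by have [] := is_derive_polyfun i p x.
Qed.

Lemma vf_apply_polyfun (R : realType) (N : nat) (X : poly_vector_field R N)
    (p : mpoly N R) : vf_apply X (polyfun p) = polyfun (vf_apply_poly X p).
Proof.
apply/funext => x; rewrite /vf_apply /vf_apply_poly /polyfun raddf_sum /=.
by apply: eq_bigr => i _; rewrite partial_polyfun mevalM.
Qed.

(** * Coordinate hyperplanes are null *)

(** The hyperplane is the union over [k] of the flat boxes with side [[-k, k]]
    in every direction except the [i]-th, where the side is the single point
    [0]; each of them has volume zero. *)
Lemma lebesgue_null_hyperplane (R : realType) (N : nat) (i : 'I_N) :
  lebesgue_null [set x : 'rV[R]_N | x 0 i = 0].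
Proof.
apply/eqP; rewrite eq_le; apply/andP; split; last first.
  apply/ereal_infP => _ [a [b [_ ->]]].
  apply: nneseries_ge0 => k _ _; rewrite lee_fin prodr_ge0 // => j _.
  by rewrite le_max lexx.
apply: ereal_inf_lbound.
pose b (k : nat) : 'rV[R]_N := \row_j (if j == i then 0 else k%:R).
exists (fun k => - b k), b; split; last first.
  rewrite eseries0 // => k _ _.
  by rewrite /box_volume (bigD1 i) //= !mxE eqxx oppr0 subrr maxxx mul0r.
move=> x /= xi0.
exists (\max_(j < N) Num.bound `|x 0 j|%R)%N => // j; rewrite !mxE.
case: eqP => [->|_]; first by rewrite xi0 oppr0 lexx.
rewrite -ler_norml ltW // (lt_le_trans (archi_boundP (normr_ge0 _))) //.
by rewrite ler_nat; apply: (leq_bigmax (F := fun j => Num.bound `|x 0 j|)).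
Qed.

(** * Multiples of a rotation field *)

Definition rotation_field (R : realType) (N : nat) (i j : 'I_N)
    (q : mpoly N R) : poly_vector_field R N :=
  fun k => if k == i then q * mvar R j
           else if k == j then - (q * mvar R i) else 0.

Lemma rotation_field_apply (R : realType) (N : nat) (i j : 'I_N)
    (q p : mpoly N R) : i != j ->
  vf_apply_poly (rotation_field i j q) p =
  q * (mvar R j * mderiv i p - mvar R i * mderiv j p).
Proof.
move=> ij; have ji : j != i by rewrite eq_sym.
rewrite /vf_apply_poly /rotation_field (bigD1 i) //= eqxx.
rewrite (bigD1 j) //= eqxx (negPf ji) big1 ?addr0; last first.
  by move=> k /andP[/negPf-> /negPf->]; rewrite mul0r.
by rewrite mulrBr !mulrA mulNr.
Qed.

Lemma mderiv_sphere_poly (R : realType) (n : nat) (i : 'I_n.+1) :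
  mderiv i (sphere_poly R n) = mvar R i *+ 2.
Proof.
rewrite /sphere_poly mderivB -(mpolyC1 n.+1 R) mderivC subr0 raddf_sum /=.
rewrite (bigD1 i) //= mderiv_mvar_sqr eqxx mul1r big1 ?addr0 // => k ki.
by rewrite mderiv_mvar_sqr (negPf ki) mul0r mul0rn.
Qed.

Lemma rotation_field_on_sphere (R : realType) (n : nat) (i j : 'I_n.+1)
    (q : mpoly n.+1 R) : i != j -> on_sphere (rotation_field i j q).
Proof.
move=> ij; exists 0; rewrite rotation_field_apply // !mderiv_sphere_poly.
by ring.
Qed.

Lemma rotation_field_degree (R : realType) (N : nat) (i j : 'I_N) (d : nat) :
  vf_degree (rotation_field i j (mvar R i ^+ d)) = d.+1.
Proof.
rewrite /vf_degree.
have degX k : (msize (mvar R i ^+ d * mvar R k)).-1 = d.+1.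
  by rewrite /mvar mpolyXn -mpolyXD msizeX mdegD mdegMn !mdeg1 mul1n addn1.
apply/eqP; rewrite eqn_leq; apply/andP; split.
  apply/bigmax_leqP => k _; rewrite /rotation_field.
  case: eqP => _; first by rewrite degX.
  by case: eqP => _; rewrite ?msizeN ?degX // msize0.
by apply: leq_trans (leq_bigmax i); rewrite /rotation_field eqxx degX.
Qed.

(** * Its first integrals *)

(** Indexing by [lift j] runs through all coordinates except [j], with
    [x_i^2 + x_j^2] in the place of [x_i].  Apart from the entry [2 x_j], which
    lies in column [j], the Jacobian matrix is then diagonal. *)
Definition rotation_integral (R : realType) (n : nat) (i j : 'I_n.+1)
    (k : 'I_n) : mpoly n.+1 R :=
  if lift j k == i then mvar R i ^+ 2 + mvar R j ^+ 2 else mvar R (lift j k).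

Lemma rotation_integral_apply (R : realType) (n : nat) (i j : 'I_n.+1)
    (q : mpoly n.+1 R) (k : 'I_n) : i != j ->
  vf_apply_poly (rotation_field i j q) (rotation_integral R i j k) = 0.
Proof.
move=> ij; rewrite rotation_field_apply // /rotation_integral.
case: eqP => [_|/eqP ki].
  rewrite !mderivD !mderiv_mvar_sqr !eqxx [j == i]eq_sym (negPf ij).
  by rewrite /=; ring.
by rewrite !mderiv_mvar (negPf ki) eq_sym (negPf (neq_lift _ _)) /=; ring.
Qed.

Lemma rotation_integral_nonconstant (R : realType) (n : nat) (i j : 'I_n.+1)
    (k : 'I_n) : i != j ->
  exists x y, polyfun (rotation_integral R i j k) x <>
              polyfun (rotation_integral R i j k) y.
Proof.
move=> ij; exists 0, (delta_mx 0 (lift j k)); apply/eqP.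
rewrite /rotation_integral; case: ifP => [/eqP ->|_].
  rewrite /polyfun !expr2 !mevalD !mevalM !mevalXU !mxE !eqxx /=.
  by rewrite [j == i]eq_sym (negPf ij) !mul0r !addr0 mul1r eq_sym oner_neq0.
by rewrite !polyfunX !mxE !eqxx eq_sym oner_neq0.
Qed.

(** Deleting column [j] of the Jacobian matrix leaves a diagonal matrix with
    entries [2 x_i] and [1]; so column [lift j k] of a vanishing combination of
    the rows forces its [k]-th coefficient to vanish. *)
Lemma rotation_integral_independent (R : realType) (n : nat)
    (i j : 'I_n.+1) (x : 'rV[R]_n.+1) : i != j -> x 0 i != 0 ->
  row_free (\matrix_(k < n) gradient (polyfun (rotation_integral R i j k)) x).
Proof.
move=> ij xi0; apply: inj_row_free => v v0; apply/rowP => k.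
have /rowP/(_ (lift j k)) := v0; rewrite !mxE (bigD1 k) //= big1 ?addr0.
  rewrite !mxE partial_polyfun /rotation_integral; case: eqP => [ki|_].
    rewrite mderivD !mderiv_mvar_sqr ki eqxx eq_sym (negPf ij).
    rewrite mul1r mul0r mul0rn addr0 -mulr_natl -mpolyC_nat.
    rewrite /polyfun mevalM mevalC mevalXU.
    by move/eqP; rewrite !mulf_eq0 pnatr_eq0 (negPf xi0) !orbF => /eqP.
  by rewrite mderiv_mvar eqxx /polyfun meval1 mulr1.
move=> l lk; rewrite !mxE partial_polyfun /rotation_integral.
have lk' : lift j l != lift j k by rewrite (inj_eq lift_inj).
case: eqP => [li|_]; last first.
  by rewrite mderiv_mvar (negPf lk') /polyfun meval0 mulr0.
rewrite mderivD !mderiv_mvar_sqr -li (negPf lk') (negPf (neq_lift _ _)).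
by rewrite !mul0r !mul0rn addr0 /polyfun meval0 mulr0.
Qed.

Theorem theorem3p5 (R : realType) (m n : nat) (hm : (0 < m)%N) (hn : (0 < n)%N) :
  exists X : poly_vector_field R n.+1,
    [/\ vf_degree X = m, on_sphere X & completely_integrable X [set: 'rV[R]_n.+1]%classic].
Proof.
pose i : 'I_n.+1 := ord0; pose j : 'I_n.+1 := ord_max.
have ij : i != j by rewrite -val_eqE /= neq_ltn hn.
exists (rotation_field i j (mvar R i ^+ m.-1)); split.
- by rewrite rotation_field_degree prednK.
- exact: rotation_field_on_sphere.
exists (fun k => polyfun (rotation_integral R i j k)); split=> [k|].
  split.
  - exact: openT.
  - exact: smooth_polyfun.
  - have [x [y xy]] := rotation_integral_nonconstant R k ij.
    by exists x, y.
  - move=> x _; rewrite vf_apply_polyfun rotation_integral_apply //.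
    by rewrite /polyfun meval0.
exists [set x | x 0 i = 0]; split; first exact: lebesgue_null_hyperplane.
by move=> x _ /eqP; exact: rotation_integral_independent.
Qed.
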